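(* Let $\mathbb{T}$ be a time scale with at least two points, let $a,b\in\mathbb{T}$ with $a<b$, and let $\alpha,\beta\in\mathbb{R}$. Let $L,\tilde L:[a,b]^{\kappa}\times\mathbb{R}\times\mathbb{R}\to\mathbb{R}$ be two Lagrangians satisfying the standing regularity assumptions given in the context, and put $$\mathcal{L}[x]=\int_a^b L(t,x^{\sigma}(t),x^{\Delta}(t))\,\Delta t,\qquad \tilde{\mathcal{L}}[\tilde x]=\int_a^b \tilde L(t,\tilde x^{\sigma}(t),\tilde x^{\Delta}(t))\,\Delta t .$$ Let $z:[a,b]\times\mathbb{R}\to\mathbb{R}$ be such that for every $t\in[a,b]$ the transformation $x=z(t,\tilde x)$ has a unique inverse $\tilde x=\tilde z(t,x)$, and such that $x(t)=z(t,\tilde x(t))$, $\tilde x(t)=\tilde z(t,x(t))$ ($t\in[a,b]$) defines a one-to-one correspondence between the set of all $x\in C^1_{prd}([a,b],\mathbb{R})$ satisfying $$x(a)=\alpha,\qquad x(b)=\beta \qquad (\ast)$$ and the set of all $\tilde x\in C^1_{prd}([a,b],\mathbb{R})$ satisfying $$\tilde x(a)=\tilde z(a,\alpha),\qquad \tilde x(b)=\tilde z(b,\beta). \qquad (\ast\ast)$$ Suppose there exists a function $G:[a,b]\times\mathbb{R}\to\mathbb{R}$ such that for all such corresponding pairs $x,\tilde x$ the functional identity $$L(t,x^{\sigma}(t),x^{\Delta}(t))-\tilde L(t,\tilde x^{\sigma}(t),\tilde x^{\Delta}(t))=G^{\Delta}(t,\tilde x(t))$$ holds. If $\tilde x^{*}$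 yields the extremum (minimum, respectively maximum) of $\tilde{\mathcal{L}}$ among all $\tilde x\in C^1_{prd}([a,b],\mathbb{R})$ satisfying $(\ast\ast)$, with $\tilde x^{*}$ satisfying $(\ast\ast)$, then $x^{*}(t)=z(t,\tilde x^{*}(t))$ yields the extremum (minimum, respectively maximum) of $\mathcal{L}$ among all $x\in C^1_{prd}([a,b],\mathbb{R})$ satisfying $(\ast)$.
   Context: A time scale $\mathbb{T}$ is a nonempty closed subset of $\mathbb{R}$, with the topology inherited from $\mathbb{R}$. The forward jump operator is $\sigma(t)=\inf\{s\in\mathbb{T}:s>t\}$ for $t<\sup\mathbb{T}$, with $\sigma(\sup\mathbb{T})=\sup\mathbb{T}$ if $\sup\mathbb{T}<+\infty$. The backward jump operator is $\rho(t)=\sup\{s\in\mathbb{T}:s<t\}$ for $t>\inf\mathbb{T}$, with $\rho(\inf\mathbb{T})=\inf\mathbb{T}$ if $\inf\mathbb{T}>-\infty$. A point $t$ is right-dense if $\sigma(t)=t$, left-dense if $\rho(t)=t$, left-scattered if $\rho(t)<t$. If $\sup\mathbb{T}$ is finite and left-scattered, $\mathbb{T}^{\kappa}=\mathbb{T}\setminus\{\sup\mathbb{T}\}$; otherwise $\mathbb{T}^\kappa=\mathbb{T}$. The interval $[a,b]$ means $[a,b]\cap\mathbb{T}$, itself regarded as a time scale (so $[a,b]^\kappa$ is defined accordingly). Write $f^{\sigma}=f\circ\sigma$. The delta derivative of $f$ at $t\in\mathbb{T}^{\kappa}$ is the real number $f^{\Delta}(t)$ such that for every $\varepsilon>0$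 there is a neighborhood $U=(t-\delta,t+\delta)\cap\mathbb{T}$ with $|f(\sigma(t))-f(s)-f^{\Delta}(t)(\sigma(t)-s)|\le\varepsilon|\sigma(t)-s|$ for all $s\in U$. A function is rd-continuous (class $C_{rd}$) if it is continuous at right-dense points and its (finite) left-sided limits exist at left-dense points. A function $g$ is piecewise rd-continuous if it is defined except possibly at finitely many points, is continuous at the right-dense points of its domain, has finite left-sided limits at left-dense points, and has finite right-sided limits at right-dense exceptional points. $C^1_{prd}([a,b],\mathbb{R})$ is the set of continuous $f:[a,b]\to\mathbb{R}$ such that $f^{\Delta}$ exists for all except possibly finitely many $t\in[a,b]^{\kappa}$ and $f^{\Delta}$ is piecewise rd-continuous. The delta integral of a piecewise rd-continuous $f$ is $\int_c^d f(t)\Delta t=F(d)-F(c)$, where $F$ is continuous and $F^{\Delta}=f$ except possibly at finitely many points. Standing regularity assumptions on a Lagrangian $L$ (and likewise on $\tilde L$): $(t,y,v)\mapsto L(t,y,v)$ has continuous partial derivatives $L_y$, $L_v$ with respect to the second and third arguments for all $t\in[a,b]^{\kappa}$, and for every $x\in C^1_{prd}([a,b],\mathbb{R})$ the functions $L$, $L_y$, $L_v$ evaluated at $(t,x^{\sigma}(t),x^{\Delta}(t))$ are piecewise rd-continuous in $t$. $G^{\Delta}(t,\tilde x(t))$ denotes the delta derivative with respect to $t$ of the composite function $t\mapsto G(t,\tilde x(t))$, which is understood to belong to $C^1_{prd}([a,b],\mathbb{R})$; the functional identity is understood for all $t\in[a,b]^{\kappa}$ except possibly the finitely many points at which one of the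 derivatives involved fails to exist. *)

(* Defs.v *)
From HB Require Import structures.
From mathcomp Require Import all_boot all_order all_algebra.
From mathcomp Require Import all_classical all_reals all_analysis.

Set Implicit Arguments.
Unset Strict Implicit.
Unset Printing Implicit Defensive.

Import Order.TTheory GRing.Theory Num.Theory.
Import numFieldNormedType.Exports.

Local Open Scope classical_set_scope.
Local Open Scope ring_scope.

(* A function on a time scale is represented by a total function R -> R; every
   definition below only looks at its values on the time scale. *)

Section TimeScale.
Context {R : realType}.
Implicit Types (T D : set R) (f g F x y : R -> R) (t : R).

Definition time_scale T := T !=set0 /\ closed T.

Definition tsitv T (a b : R) : set R := T `&` `[a, b].

Definition sigma T t : R :=
  if (t%:E < ereal_sup (EFin @` T))%E then inf [set s | T s /\ t < s] else t.

Definition rho T t : R :=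
  if (ereal_inf (EFin @` T) < t%:E)%E then sup [set s | T s /\ s < t] else t.

Definition right_dense T t := sigma T t = t.
Definition left_dense T t := rho T t = t.
Definition left_scattered T t := rho T t < t.

Definition kappa T : set R :=
  T `\` [set t | t%:E = ereal_sup (EFin @` T) /\ left_scattered T t].

Definition is_delta_deriv T f t (d : R) :=
  forall e : R, 0 < e -> exists2 r : R, 0 < r &
    forall s, T s -> t - r < s < t + r ->
      `|f (sigma T t) - f s - d * (sigma T t - s)| <= e * `|sigma T t - s|.

Definition delta_dom T f : set R :=
  [set t | kappa T t /\ exists d, is_delta_deriv T f t d].

(* Junk value 0 outside delta_dom T f. *)
Definition delta_deriv T f t : R := xget 0 [set d | is_delta_deriv T f t d].

(* D is the domain of the partial function g, so T `\` D is its set of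
   exceptional points.  By the conventions on sigma and rho, the maximum of T is
   right-dense and the minimum is left-dense; the corresponding one-sided limit
   conditions there are vacuous (trivial filter). *)
Definition piecewise_rd T D g :=
  [/\ D `<=` T /\ finite_set (T `\` D),
      forall t, D t -> right_dense T t -> g s @[s --> within D (nbhs t)] --> g t,
      forall t, T t -> left_dense T t ->
        exists l : R, g s @[s --> within D t^'-] --> l
    & forall t, (T `\` D) t -> right_dense T t ->
        exists l : R, g s @[s --> within D t^'+] --> l].

Definition C1prd T f :=
  [/\ {within T, continuous f},
      finite_set (kappa T `\` delta_dom T f)
    & piecewise_rd T (delta_dom T f) (delta_deriv T f)].

(* The finitely many exceptional points are right-dense: continuity of F does
   not constrain F (sigma t) - F t at a right-scattered t, so an exception there
   would leave F d - F c undetermined.  For the integrands considered here this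
   excludes nothing, as a continuous function is delta differentiable at every
   right-scattered point. *)
Definition delta_antideriv T f F :=
  [/\ {within T, continuous F},
      finite_set [set t | kappa T t /\ ~ is_delta_deriv T F t (f t)]
    & forall t, kappa T t -> ~ right_dense T t -> is_delta_deriv T F t (f t)].

Definition delta_int T f (c d : R) : R :=
  xget 0 [set v | exists2 F, delta_antideriv T f F & v = F d - F c].

(* t |-> L (t, x (sigma t), x^Delta t), with domain delta_dom T x. *)
Definition along T (L : R -> R -> R -> R) x t : R :=
  L t (x (sigma T t)) (delta_deriv T x t).

Definition partial_y (L : R -> R -> R -> R) t (u v : R) : R :=
  derive1 (fun w : R => L t w v) u.
Definition partial_v (L : R -> R -> R -> R) t (u v : R) : R :=
  derive1 (fun w : R => L t u w) v.

Definition regular_lagrangian T (L : R -> R -> R -> R) :=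
  (forall t, kappa T t ->
    [/\ forall u v : R, derivable (fun w : R => L t w v) u 1,
        forall u v : R, derivable (fun w : R => L t u w) v 1,
        continuous (fun p : R * R => partial_y L t p.1 p.2)
      & continuous (fun p : R * R => partial_v L t p.1 p.2)]) /\
  (forall x, C1prd T x ->
    [/\ piecewise_rd T (delta_dom T x) (along T L x),
        piecewise_rd T (delta_dom T x) (along T (partial_y L) x)
      & piecewise_rd T (delta_dom T x) (along T (partial_v L) x)]).

Definition admissible T (a b A B : R) : set (R -> R) :=
  [set x | [/\ C1prd T x, x a = A & x b = B]].

Definition corresponding T (z zt : R -> R -> R) x y :=
  forall t, T t -> x t = z t (y t) /\ y t = zt t (x t).

(* One-to-one correspondence given by a relation; functions on T being
   represented by total functions, uniqueness is up to equality on T. *)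
Definition one_to_one T (P Q : set (R -> R))
    (rel : (R -> R) -> (R -> R) -> Prop) :=
  (forall x, P x -> exists2 y, Q y /\ rel x y &
     forall y', Q y' -> rel x y' -> forall t, T t -> y' t = y t) /\
  (forall y, Q y -> exists2 x, P x /\ rel x y &
     forall x', P x' -> rel x' y -> forall t, T t -> x' t = x t).

Definition minimizer (P : set (R -> R)) (J : (R -> R) -> R) x :=
  P x /\ forall y, P y -> J x <= J y.
Definition maximizer (P : set (R -> R)) (J : (R -> R) -> R) x :=
  P x /\ forall y, P y -> J y <= J x.

End TimeScale.

(* Main.v *)
Require Import Defs.
From HB Require Import structures.
From mathcomp Require Import all_boot all_order all_algebra.
From mathcomp Require Import all_classical all_reals all_analysis.
From mathcomp Require Import lra.

(** If [x] and [xt] correspond, then integrating the functional identity gives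
      L[x] = Lt[xt] + (G(b, xt(b)) - G(a, xt(a))),
    and the boundary conditions make the last term a constant, the same for all
    corresponding pairs.  The two functionals thus differ by a constant along
    the correspondence, which therefore preserves minimizers and maximizers.

    The integration step carries the weight of the proof.  The delta integral is
    defined through antiderivatives and takes an arbitrary value when there is
    none, so two facts about the compact time scale [S = T `&` [a, b]] are
    required.

    Uniqueness ([delta_antideriv_unique]): a continuous function whose delta
    derivative vanishes off finitely many right-dense points takes equal values
    at [a] and [b] ([delta_deriv0_const]).  This is a mean value estimate, proved
    by induction along the time scale ([time_scale_ind]).

    Existence ([piecewise_rd_antideriv]): a piecewise rd-continuous function [f]
    is bounded, again by induction along [S].  For bounded [f] there is a function
    [F] whose increment over [[u, v[] lies between [c1 * (v - u)] and
    [c2 * (v - u)] whenever [c1 <= f <= c2] on [S `&` [u, v[]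
    ([mean_value_function]).  Such an [F] has delta derivative [f t] at every
    right-scattered [t] and at every right-dense point of continuity of [f].

    Given an antiderivative [F] of the integrand of L along [x], the function
    [F - G(., xt)] is then an antiderivative of the integrand of Lt along [xt]
    ([delta_intB]).  The exceptional points of the derivatives involved are
    right-dense, because a continuous function is delta differentiable at every
    right-scattered point ([right_scattered_is_delta_deriv]). *)

Set Implicit Arguments.
Unset Strict Implicit.
Unset Printing Implicit Defensive.

Import Order.TTheory GRing.Theory Num.Theory.
Import numFieldNormedType.Exports.

Local Open Scope classical_set_scope.
Local Open Scope ring_scope.

(** * Jump operators of a compact time scale *)

Section CompactTimeScale.
Context {R : realType} (S : set R) (a b : R).
Hypotheses (Scl : closed S) (Sa : S a) (Sb : S b).
Hypothesis (Sab : forall t, S t -> a <= t <= b).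
Implicit Types (f F : R -> R) (D : set R) (s t u v : R).

Lemma closed_approx t :
  (forall e : R, 0 < e -> exists2 s, S s & `|t - s| < e) -> S t.
Proof.
move=> H; apply: Scl => B /nbhs_ballP[e /= e0 Be].
by have [s Ss se] := H e e0; exists s; split=> //; apply: Be.
Qed.

Lemma ereal_sup_ts : ereal_sup (EFin @` S) = b%:E.
Proof.
apply/eqP; rewrite eq_le; apply/andP; split.
  by apply: ge_ereal_sup => _ [s Ss <-]; rewrite lee_fin; case/andP: (Sab Ss).
by apply: ereal_sup_ubound; exists b.
Qed.

Lemma ereal_inf_ts : ereal_inf (EFin @` S) = a%:E.
Proof.
apply/eqP; rewrite eq_le; apply/andP; split.
  by apply: ereal_inf_lbound; exists a.
by apply: le_ereal_inf_tmp => _ [s Ss <-]; rewrite lee_fin; case/andP: (Sab Ss).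
Qed.

Lemma sigmaE t : sigma S t = if t < b then inf [set s | S s /\ t < s] else t.
Proof. by rewrite /sigma ereal_sup_ts lte_fin. Qed.

Lemma rhoE t : rho S t = if a < t then sup [set s | S s /\ s < t] else t.
Proof. by rewrite /rho ereal_inf_ts lte_fin. Qed.

Lemma has_inf_gt t : t < b -> has_inf [set s | S s /\ t < s].
Proof.
by move=> tb; split; [exists b | exists t => s [_ /ltW]].
Qed.

Lemma has_sup_lt t : a < t -> has_sup [set s | S s /\ s < t].
Proof.
by move=> at_; split; [exists a | exists t => s [_ /ltW]].
Qed.

Lemma sigma_ge t : t <= sigma S t.
Proof.
rewrite sigmaE; case: ifPn => // tb.
by apply: lb_le_inf => [|s [_ /ltW]//]; exists b.
Qed.

Lemma sigma_le s t : S s -> t < s -> sigma S t <= s.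
Proof.
move=> Ss ts; have tb : t < b by case/andP: (Sab Ss) => _; apply: lt_le_trans.
by rewrite sigmaE tb; apply: ge_inf => //; apply: (has_inf_gt tb).2.
Qed.

Lemma sigma_in t : S t -> S (sigma S t).
Proof.
move=> St; case: (ltP t b) => tb; last by rewrite sigmaE ltNge tb.
apply: closed_approx => e e0; have [s [Ss ts]] := inf_adherent e0 (has_inf_gt tb).
have := sigma_le Ss ts; rewrite sigmaE tb => le1 lt1.
by exists s; rewrite // distrC ger0_norm ?subr_ge0// ltrBlDl.
Qed.

Lemma right_scattered_lt t : ~ right_dense S t -> t < sigma S t.
Proof. by move/eqP; rewrite lt_def sigma_ge andbT. Qed.

Lemma right_scattered_ltb t : ~ right_dense S t -> t < b.
Proof. by rewrite /right_dense sigmaE; case: ifP. Qed.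

Lemma right_dense_near t e : t < b -> right_dense S t -> 0 < e ->
  exists2 s, S s & t < s < t + e.
Proof.
move=> tb td e0; have [s [Ss ts] se] := inf_adherent e0 (has_inf_gt tb).
by move: td se; rewrite /right_dense sigmaE tb => ->; exists s; rewrite // ts.
Qed.

Lemma left_dense_near t e : a < t -> left_dense S t -> 0 < e ->
  exists2 s, S s & t - e < s < t.
Proof.
move=> ta td e0; have [s [Ss ts] se] := sup_adherent e0 (has_sup_lt ta).
by move: td se; rewrite /left_dense rhoE ta => ->; exists s; rewrite // ts andbT.
Qed.

Lemma left_scattered_gap t : a < t -> ~ left_dense S t ->
  exists2 r, r < t & forall s, S s -> s < t -> s <= r.
Proof.
rewrite /left_dense rhoE => ta; rewrite ta => /eqP nd.
have ub s : S s -> s < t -> s <= sup [set s | S s /\ s < t].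
  by move=> Ss st; apply: ub_le_sup => //; apply: (has_sup_lt ta).2.
exists (sup [set s | S s /\ s < t]) => //.
rewrite lt_neqAle nd; apply: ge_sup => [|s [_ /ltW]//].
by exists a.
Qed.

Lemma kappa_sub t : kappa S t -> S t.
Proof. by case. Qed.

Lemma kappa_lt t : S t -> t < b -> kappa S t.
Proof.
by move=> St tb; split=> // -[]; rewrite ereal_sup_ts => -[tb1]; rewrite tb1 ltxx in tb.
Qed.

(** Time-scale induction: the set of points up to which [P] holds has a
    supremum, which the left-dense clause puts in the set and which the two
    successor clauses forbid to be smaller than [b]. *)
Lemma time_scale_ind (P : R -> Prop) :
  P a ->
  (forall t, S t -> t < b -> ~ right_dense S t -> P t -> P (sigma S t)) ->
  (forall t, S t -> t < b -> right_dense S t -> P t ->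
     exists2 d, 0 < d & forall s, S s -> t < s < t + d -> P s) ->
  (forall t, S t -> a < t -> left_dense S t ->
     (forall s, S s -> s < t -> P s) -> P t) ->
  forall t, S t -> P t.
Proof.
move=> Pa Psc Prd Pld.
pose A := [set t | S t /\ forall s, S s -> s <= t -> P s].
have Aa : A a.
  split=> // s Ss sa; suff -> : s = a by [].
  by apply/eqP; rewrite eq_le sa; case/andP: (Sab Ss).
have supA : has_sup A by split; [exists a | exists b => t [/Sab/andP[]]].
pose c := sup A.
have cub t : A t -> t <= c by move=> At; apply: ub_le_sup => //; exact: supA.2.
have Sc : S c.
  apply: closed_approx => e e0; have [s As se] := sup_adherent e0 supA.
  exists s; first by case: As.
  by rewrite ger0_norm ?subr_ge0 ?cub// ltrBlDl -ltrBlDr.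
have ltc s : S s -> s < c -> P s.
  move=> Ss sc; have e0 : 0 < c - s by rewrite subr_gt0.
  have [u [Su Pu] us] := sup_adherent e0 supA.
  by apply: Pu => //; move: us; rewrite -/c subKr => /ltW.
have Pc : P c.
  case: (ltP a c) => [ac|ca]; last first.
    by suff -> : c = a by []; apply/eqP; rewrite eq_le ca; case/andP: (Sab Sc).
  case: (pselect (left_dense S c)) => [ld|nld]; first exact: Pld.
  have [r rc gap] := left_scattered_gap ac nld.
  have e0 : 0 < c - r by rewrite subr_gt0.
  have [u [Su Pu]] := sup_adherent e0 supA; rewrite -/c subKr => ru.
  apply: Pu => //; rewrite leNgt; apply/negP => uc.
  by move: ru; rewrite ltNge gap.
have Ac : A c.
  by split=> // s Ss; rewrite le_eqVlt => /orP[/eqP->//|]; exact: ltc.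
suff cb : b <= c.
  move=> t St; case: Ac => _; apply=> //.
  by apply: le_trans cb; case/andP: (Sab St).
rewrite leNgt; apply/negP => cb.
case: (pselect (right_dense S c)) => [rd|nrd].
  have [d d0 Pd] := Prd c Sc cb rd Pc.
  have [s Ss /andP[cs sd]] := right_dense_near cb rd d0.
  suff /cub : A s by rewrite leNgt cs.
  split=> // u Su us; case: (leP u c) => uc; first by case: Ac => _; exact.
  by apply: Pd => //; rewrite uc (le_lt_trans us).
suff /cub : A (sigma S c) by rewrite leNgt right_scattered_lt.
split=> [|u Su us]; first exact: sigma_in.
case: (leP u c) => uc; first by case: Ac => _; exact.
have -> : u = sigma S c by apply/eqP; rewrite eq_le us sigma_le.
exact: Psc.
Qed.

(** * Delta derivatives and uniqueness of antiderivatives *)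

Lemma cvg_within_near D f t l e : f s @[s --> within D (nbhs t)] --> l ->
  0 < e ->
  exists2 d, 0 < d & forall s, D s -> t - d < s < t + d -> `|f s - l| <= e.
Proof.
move=> /cvgrPdist_le H e0; have := H e e0.
rewrite near_withinE => /nbhs_ballP[d /= d0 Bd]; exists d => // s Ds sd.
by rewrite distrC; apply: Bd => //; rewrite /ball /= distrC ltr_distl.
Qed.

Lemma continuous_tsP F : {within S, continuous F} <->
  forall t e, S t -> 0 < e -> exists2 d, 0 < d &
    forall s, S s -> t - d < s < t + d -> `|F s - F t| <= e.
Proof.
rewrite subspace_continuousP; split=> [cF t e St e0|H t St].
  by apply: cvg_within_near => //; apply: cF.
apply/cvgrPdist_le => e e0; have [d d0 Hd] := H t e St e0.
rewrite near_withinE; apply/nbhs_ballP; exists d => //= s sd Ss.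
by rewrite distrC; apply: Hd => //; rewrite -ltr_distl distrC.
Qed.

Lemma continuous_tsB f g : {within S, continuous f} ->
  {within S, continuous g} -> {within S, continuous (fun t => f t - g t)}.
Proof. by move=> cf cg t; apply: cvgB; [exact: cf | exact: cg]. Qed.

Lemma is_delta_derivB f g t c d : is_delta_deriv S f t c ->
  is_delta_deriv S g t d -> is_delta_deriv S (fun t => f t - g t) t (c - d).
Proof.
move=> df dg e e0; have e20 : 0 < e / 2 by lra.
have [r r0 Hr] := df _ e20; have [q q0 Hq] := dg _ e20.
exists (Num.min r q) => [|s Ss]; first by rewrite lt_min r0.
have mr : Num.min r q <= r by rewrite ge_min lexx.
have mq : Num.min r q <= q by rewrite ge_min lexx orbT.
move=> /andP[s1 s2].
have {}Hr := Hr s Ss ltac:(lra); have {}Hq := Hq s Ss ltac:(lra).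
rewrite mulrBl.
have -> : f (sigma S t) - g (sigma S t) - (f s - g s) -
    (c * (sigma S t - s) - d * (sigma S t - s)) =
  (f (sigma S t) - f s - c * (sigma S t - s)) -
  (g (sigma S t) - g s - d * (sigma S t - s)) by lra.
by apply: (le_trans (ler_normB _ _)); lra.
Qed.

Lemma eq_is_delta_deriv f g t d : S t -> {in S, f =1 g} ->
  is_delta_deriv S f t d -> is_delta_deriv S g t d.
Proof.
move=> St fg df e e0; have [r r0 Hr] := df e e0; exists r => // s Ss.
by rewrite -!fg ?inE//; [exact: Hr | exact: sigma_in].
Qed.

Lemma eq0_small (x C : R) : 0 <= C ->
  (forall e : R, 0 < e -> `|x| <= e * C) -> x = 0.
Proof.
move=> C0 H; apply/eqP; rewrite -normr_le0; apply/ler_addgt0Pr => e e0.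
rewrite add0r; apply: (le_trans (H (e / (C + 1)) _)).
  by rewrite divr_gt0// ltr_wpDl.
rewrite mulrAC ler_pdivrMr ?ltr_wpDl// ler_pM2l// lerDl.
exact: ler01.
Qed.

Lemma delta_deriv_scattered F t d : S t -> is_delta_deriv S F t d ->
  F (sigma S t) - F t = d * (sigma S t - t).
Proof.
move=> St dF; apply/subr0_eq; apply: (@eq0_small _ `|sigma S t - t|) => // e e0.
by have [r r0 Hr] := dF e e0; apply: Hr => //; lra.
Qed.

(** At a right-scattered point the difference quotient has a denominator
    bounded away from [0], so continuity alone gives differentiability. *)
Lemma right_scattered_is_delta_deriv F t d : {within S, continuous F} ->
  S t -> ~ right_dense S t -> F (sigma S t) - F t = d * (sigma S t - t) ->
  is_delta_deriv S F t d.
Proof.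
move=> /continuous_tsP cF St nrd dE e e0.
have mu0 := right_scattered_lt nrd.
pose m := sigma S t - t; have m0 : 0 < m by rewrite /m; lra.
have k0 : 0 < `|d| + 1 by rewrite ltr_wpDl.
have em0 : 0 < e * m / 2 by rewrite divr_gt0// mulr_gt0.
have [r r0 Hr] := cF t _ St em0.
pose q := e * m / 2 / (`|d| + 1).
have q0 : 0 < q by rewrite divr_gt0.
exists (Num.min r (Num.min m q)) => [|s Ss].
  by rewrite !lt_min r0 m0 q0.
have mr : Num.min r (Num.min m q) <= r by rewrite ge_min lexx.
have mm : Num.min r (Num.min m q) <= m by rewrite !ge_min lexx orbT.
have mq : Num.min r (Num.min m q) <= q by rewrite !ge_min lexx !orbT.
move=> /andP[s1 s2].
have st : s <= t.
  by rewrite leNgt; apply/negP => /(sigma_le Ss); rewrite /m in mm; lra.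
have {}Hr := Hr s Ss ltac:(lra).
have -> : F (sigma S t) - F s - d * (sigma S t - s) =
  - (F s - F t) - d * (t - s) by lra.
have dq : `|d * (t - s)| <= e * m / 2.
  rewrite normrM (ger0_norm (_ : 0 <= t - s)); last by lra.
  apply: (@le_trans _ _ ((`|d| + 1) * q)); last by rewrite mulrC divfK// gt_eqF.
  by apply: ler_pM => //; lra.
apply: (le_trans (ler_normB _ _)); rewrite normrN.
apply: (@le_trans _ _ (e * m)); first by lra.
rewrite ler_pM2l// (ger0_norm (_ : 0 <= sigma S t - s)) /m; lra.
Qed.

(** Every exceptional point is allowed to cost [e]: the bound
    [e * (t - a) + e * #{x in E | x < t}] on the increment of [F] is propagated
    by induction, continuity paying for the jump of the count at a point
    of [E].  Right-density of the exceptional points is what makes continuity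
    sufficient there. *)
Lemma delta_deriv0_const F (E : set R) : {within S, continuous F} ->
  finite_set E -> (forall t, E t -> right_dense S t) ->
  (forall t, S t -> t < b -> ~ E t -> is_delta_deriv S F t 0) ->
  F b = F a.
Proof.
move=> /continuous_tsP cF /finite_seqP[r ->] Erd dF.
pose n t : R := (count (< t) r)%:R.
have n_le s t : s <= t -> n s <= n t.
  by move=> st; rewrite ler_nat; apply: sub_count => x /= xs; exact: lt_le_trans st.
have n_lt s t : s \in r -> s < t -> n s + 1 <= n t.
  move=> sr st; rewrite natr1 ler_nat.
  have := count_predUI (< s) (pred1 s) r.
  rewrite (_ : count (predI _ _) r = 0%N) ?addn0; last first.
    rewrite -(count_pred0 r); apply: eq_count => x /=.
    by case: eqP => [->|]; rewrite ?ltxx ?andbF.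
  have : (0 < count (pred1 s) r)%N by rewrite -has_count has_pred1.
  move=> c0 cE; rewrite -addn1.
  apply: (@leq_trans (count (predU (< s) (pred1 s)) r)).
    by rewrite cE leq_add2l.
  by apply: sub_count => x /= /orP[xs|/eqP->//]; exact: lt_trans st.
have bd e : 0 < e -> forall t, S t -> `|F t - F a| <= e * (t - a + n t).
  move=> e0; apply: time_scale_ind.
  - by rewrite !subrr normr0 add0r pmulr_rge0// ler0n.
  - move=> t St tb nrd IH.
    have /(delta_deriv_scattered St) : is_delta_deriv S F t 0.
      by apply: dF => // /Erd.
    rewrite mul0r => /subr0_eq ->; apply: (le_trans IH).
    by rewrite ler_pM2l// lerD// ?lerD2r ?n_le// sigma_ge.
  - move=> t St tb rd IH; case: (pselect (t \in r)) => [tr|tnr].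
      have [d d0 Hd] := cF t e St e0; exists d => // s Ss /andP[ts sd].
      have {}Hd := Hd s Ss ltac:(lra).
      have -> : F s - F a = (F s - F t) + (F t - F a) by lra.
      apply: (le_trans (ler_normD _ _)).
      apply: (@le_trans _ _ (e * (t - a + n t + 1))); first by lra.
      by rewrite ler_pM2l//; have := n_lt _ _ tr ts; lra.
    have [d d0 Hd] := dF t St tb tnr e e0; exists d => // s Ss /andP[ts sd].
    have := Hd s Ss ltac:(lra); rewrite rd mul0r subr0 distrC.
    rewrite (distrC t) (ger0_norm (_ : 0 <= s - t)) => [{}Hd|]; last by lra.
    have -> : F s - F a = (F s - F t) + (F t - F a) by lra.
    apply: (le_trans (ler_normD _ _)).
    apply: (@le_trans _ _ (e * (s - t) + e * (t - a + n t))); first by lra.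
    by rewrite -mulrDr ler_pM2l//; have := n_le _ _ (ltW ts); lra.
  - move=> t St at_ ld IH; apply/ler_addgt0Pr => h h0.
    have [d d0 Hd] := cF t h St h0.
    have [s Ss /andP[s1 s2]] := left_dense_near at_ ld d0.
    have {}IH := IH s Ss s2; have {}Hd := Hd s Ss ltac:(lra).
    have -> : F t - F a = (F s - F a) - (F s - F t) by lra.
    apply: (le_trans (ler_normB _ _)); rewrite lerD//.
    apply: (le_trans IH); rewrite ler_pM2l//.
    by have := n_le _ _ (ltW s2); lra.
apply/subr0_eq; apply: (@eq0_small _ (b - a + n b)) => [|e e0]; last exact: bd.
by rewrite addr_ge0 ?/n ?ler0n// subr_ge0; case/andP: (Sab Sa).
Qed.

Lemma delta_antideriv_unique f F1 F2 : delta_antideriv S f F1 ->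
  delta_antideriv S f F2 -> F1 b - F1 a = F2 b - F2 a.
Proof.
case=> c1 f1 rs1 [c2 f2 rs2].
suff : F1 b - F2 b = F1 a - F2 a by lra.
pose E1 := [set t | kappa S t /\ ~ is_delta_deriv S F1 t (f t)].
pose E2 := [set t | kappa S t /\ ~ is_delta_deriv S F2 t (f t)].
apply: (@delta_deriv0_const (fun t => F1 t - F2 t) (E1 `|` E2)).
- exact: continuous_tsB.
- by rewrite finite_setU.
- by move=> t [|] [tk nd]; apply: contrapT => nrd; apply: nd; [exact: rs1|exact: rs2].
- move=> t St tb nE; rewrite -(subrr (f t)).
  have tk := kappa_lt St tb.
  by apply: is_delta_derivB; apply: contrapT => nd; apply: nE; [left|right].
Qed.

Lemma delta_int_antideriv f F : delta_antideriv S f F ->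
  delta_int S f a b = F b - F a.
Proof.
move=> FA; apply: xget_unique; first by exists F.
by move=> _ [G GA ->]; apply: delta_antideriv_unique GA FA.
Qed.

(** * Existence of antiderivatives *)

(** One-sided limits make [f] bounded near each point on either side, and
    induction along [S] plays the part of a compactness argument. *)
Lemma piecewise_rd_bounded D f : piecewise_rd S D f ->
  exists2 K, 0 <= K & forall t, S t -> `|f t| <= K.
Proof.
case=> [[DS Sfin] cf lf rf].
have aux (t l K : R) : 0 <= K -> `|f t - l| <= 1 -> `|f t| <= K + `|l| + 1.
  move=> K0 ftl; have -> : f t = f t - l + l by lra.
  by apply: (le_trans (ler_normD _ _)); lra.
have [K K0 HK] : exists2 K, 0 <= K & forall s, D s -> s <= b -> `|f s| <= K.
  apply: (@time_scale_ind
    (fun t => exists2 K, 0 <= K & forall s, D s -> s <= t -> `|f s| <= K)) => //.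
  - exists `|f a| => // s Ds sa; suff -> : s = a by [].
    by apply/eqP; rewrite eq_le sa; case/andP: (Sab (DS s Ds)).
  - move=> t St tb nrd [K K0 HK]; exists (K + `|f (sigma S t)|) => [|s Ds st].
      by rewrite addr_ge0.
    case: (leP s t) => [/(HK s Ds)|ts]; first by move/le_trans; apply; rewrite lerDl.
    suff -> : s = sigma S t by rewrite lerDr.
    by apply/eqP; rewrite eq_le st; apply: sigma_le => //; exact: DS.
  - move=> t St tb rd [K K0 HK].
    have [l [d d0 Hd]] : exists l, exists2 d, 0 < d &
        forall s, D s -> t < s < t + d -> `|f s - l| <= 1.
      case: (pselect (D t)) => [Dt|nDt].
        have [d d0 Hd] := cvg_within_near (cf t Dt rd) ltr01.
        by exists (f t), d => // s Ds /andP[s1 s2]; apply: Hd => //; lra.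
      have [l /cvgrPdist_le/(_ 1 ltr01)] := rf t (conj St nDt) rd.
      rewrite 2!near_withinE => /nbhs_ballP[d /= d0 Bd].
      exists l, d => // s Ds /andP[s1 s2]; rewrite distrC; apply: Bd => //.
      by rewrite /ball /= distrC ltr_distl; lra.
    exists d => // s Ss /andP[ts sd]; exists (K + `|l| + 1) => [|u Du us].
      by rewrite !addr_ge0.
    case: (leP u t) => [/(HK u Du)|tu]; last first.
      by apply: aux => //; apply: Hd => //; rewrite tu (le_lt_trans us).
    by move/le_trans; apply; rewrite -addrA lerDl addr_ge0.
  - move=> t St at_ ld IH.
    have [l /cvgrPdist_le/(_ 1 ltr01)] := lf t St ld.
    rewrite 2!near_withinE => /nbhs_ballP[d /= d0 Bd].
    have [s Ss /andP[s1 s2]] := left_dense_near at_ ld d0.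
    have [K K0 HK] := IH s Ss s2.
    exists (K + `|l| + 1 + `|f t|) => [|u Du]; first by rewrite !addr_ge0.
    rewrite le_eqVlt => /orP[/eqP->|ut]; first by rewrite lerDr !addr_ge0.
    apply: (@le_trans _ _ (K + `|l| + 1)); last by rewrite lerDl.
    case: (leP u s) => [/(HK u Du)|su].
      by move/le_trans; apply; rewrite -addrA lerDl addr_ge0.
    apply: aux => //; rewrite distrC; apply: Bd => //.
    by rewrite /ball /= distrC ltr_distl; lra.
have /finite_seqP[r rE] := Sfin.
exists (K + \sum_(x <- r) `|f x|) => [|t St].
  by rewrite addr_ge0// sumr_ge0.
case: (pselect (D t)) => [Dt|nDt].
  apply: (le_trans (HK t Dt _)); first by case/andP: (Sab St).
  by rewrite lerDl sumr_ge0.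
have tr : t \in r by have : (S `\` D) t by []; rewrite rE.
rewrite (perm_big _ (perm_to_rem tr)) /= big_cons addrCA lerDl.
by rewrite addr_ge0// sumr_ge0.
Qed.

(** A pointwise infimum of such functions [M] is again one, because every clause
    bounds an increment of [M] from below; a two-sided condition would not
    survive the infimum.  The cut-off [t] lets an estimate be extended beyond
    the interval on which it is given. *)
Definition upper_estimate f t : set (R -> R) :=
  [set M | forall u v c, S u -> S v -> u <= v -> v <= t ->
     (forall w, S w -> u <= w < v -> c <= f w) -> c * (v - u) <= M v - M u].

(** An upper Darboux integral of [f], obtained with neither partitions nor
    measurability: [F t] is the infimum of [M t - M a] over the upper estimates
    [M] up to [t].  The lower bound on increments passes to the infimum.  The
    upper bound holds by minimality: an upper estimate up to [u] stays one when
    it is continued beyond [u] with slope [c], for any upper bound [c] of [f] on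
    [[u, v[]. *)
Lemma mean_value_function f K : (forall t, S t -> `|f t| <= K) ->
  exists F, forall u v c, S u -> S v -> u <= v ->
    ((forall w, S w -> u <= w < v -> c <= f w) -> c * (v - u) <= F v - F u) /\
    ((forall w, S w -> u <= w < v -> f w <= c) -> F v - F u <= c * (v - u)).
Proof.
move=> fK.
have fKb t : S t -> - K <= f t <= K by move=> St; rewrite -ler_norml fK.
pose A t := [set M t - M a | M in upper_estimate f t].
have infA t : S t -> has_inf (A t).
  move=> St; have /andP[at_ tb] := Sab St; split.
    exists (K * t - K * a), (fun s => K * s) => // u v c Su Sv uv vt cf.
    case: (ltrgtP u v) uv => // [uv _|-> _]; last by rewrite !subrr mulr0.
    have : c <= K by apply: (le_trans (cf u Su _)); [rewrite lexx | case/andP: (fKb u Su)].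
    by rewrite -mulrBr; apply: ler_wpM2r; lra.
  exists (- K * (t - a)) => _ [M HM <-]; apply: HM => // w Sw _.
  by case/andP: (fKb w Sw).
pose F t := inf (A t).
exists F => u v c Su Sv uv; have /andP[au ub] := Sab Su; split=> [cf|fc].
  suff : F u + c * (v - u) <= F v by lra.
  apply: lb_le_inf => [|_ [M HM <-]]; first exact: (infA v Sv).1.
  have HMu : upper_estimate f u M.
    by move=> p q c' Sp Sq pq qu; apply: HM => //; lra.
  have : F u <= M u - M a by apply: ge_inf; [exact: (infA u Su).2 | exists M].
  by have := HM u v c Su Sv uv (lexx _) cf; lra.
suff : F v - c * (v - u) <= F u by lra.
apply: lb_le_inf => [|_ [M HM <-]]; first exact: (infA u Su).1.
pose M' s := if s <= u then M s else M u + c * (s - u).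
have HM' : upper_estimate f v M'.
  move=> p q c' Sp Sq pq qv cf; rewrite /M'.
  case: (leP q u) => [qu|uq]; first by rewrite (le_trans pq qu); exact: HM.
  have c'c w : S w -> p <= w -> u <= w -> w < q -> c' <= c.
    move=> Sw pw uw wq; apply: (@le_trans _ _ (f w)).
      by apply: cf => //; rewrite pw.
    by apply: fc => //; rewrite uw (lt_le_trans wq).
  case: (leP p u) => [pu|up].
    have h1 : c' * (u - p) <= M u - M p.
      by apply: HM => // w Sw /andP[pw wu]; apply: cf => //; rewrite pw (lt_trans wu).
    have h2 : c' * (q - u) <= c * (q - u).
      by rewrite ler_wpM2r ?subr_ge0 ?(ltW uq)//; apply: (c'c u).
    have -> : c' * (q - p) = c' * (u - p) + c' * (q - u) by lra.
    by lra.
  have -> : M u + c * (q - u) - (M u + c * (p - u)) = c * (q - p) by lra.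
  case: (ltrgtP p q) pq => // [pq _|-> _]; last by rewrite !subrr !mulr0.
  by rewrite ler_wpM2r ?subr_ge0 ?(ltW pq)//; apply: (c'c p) => //; exact: ltW.
have : F v <= M' v - M' a by apply: ge_inf; [exact: (infA v Sv).2 | exists M'].
rewrite /M' au; case: (leP v u) => [vu|_]; last by lra.
have -> : v = u by apply/eqP; rewrite eq_le vu.
by rewrite subrr mulr0 subr0.
Qed.

(** At a right-scattered [t] the only point of [S] in [[t, sigma S t[] is [t],
    so the increment of the mean value function there is exactly
    [f t * (sigma S t - t)]; at a right-dense [t] at which [f] is continuous its
    increments near [t] are those of [f t] up to a small factor. *)
Lemma piecewise_rd_antideriv D f : piecewise_rd S D f ->
  exists F, delta_antideriv S f F.
Proof.
move=> fprd; have [K K0 fK] := piecewise_rd_bounded fprd.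
have [[DS Sfin] cf _ _] := fprd.
have [F HF] := mean_value_function fK.
have est c e u v : S u -> S v -> u <= v ->
    (forall w, S w -> u <= w < v -> `|f w - c| <= e) ->
    `|F v - F u - c * (v - u)| <= e * (v - u).
  move=> Su Sv uv fce; rewrite ler_norml.
  have := (HF u v (c - e) Su Sv uv).1; have := (HF u v (c + e) Su Sv uv).2.
  rewrite mulrDl mulrBl => h1 h2.
  have {}h1 : F v - F u <= c * (v - u) + e * (v - u).
    by apply: h1 => w Sw wuv; have := fce w Sw wuv; rewrite ler_norml; lra.
  have {}h2 : c * (v - u) - e * (v - u) <= F v - F u.
    by apply: h2 => w Sw wuv; have := fce w Sw wuv; rewrite ler_norml; lra.
  by lra.
have cF : {within S, continuous F}.
  apply/continuous_tsP => t e St e0.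
  have K1 : 0 < K + 1 by lra.
  exists (e / (K + 1)) => [|s Ss /andP[s1 s2]]; first exact: divr_gt0.
  have lip u v : S u -> S v -> u <= v -> v - u < e / (K + 1) ->
      `|F v - F u| <= e.
    move=> Su Sv uv vu; have := @est 0 K u v Su Sv uv.
    rewrite mul0r subr0 => H; apply: (le_trans (H _)).
      by move=> w Sw _; rewrite subr0 fK.
    apply: (@le_trans _ _ ((v - u) * (K + 1))); first by nra.
    by rewrite -ler_pdivlMr// ltW.
  case: (leP t s) => [ts|/ltW st]; first by apply: lip => //; lra.
  by rewrite distrC; apply: lip => //; lra.
have rsF t : S t -> ~ right_dense S t -> is_delta_deriv S F t (f t).
  move=> St nrd; apply: right_scattered_is_delta_deriv => //; apply/subr0_eq.
  have Sst := sigma_in St; have ts := right_scattered_lt nrd.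
  apply/eqP; rewrite -normr_le0 -(mul0r (sigma S t - t)).
  apply: est => // [|w Sw /andP[tw ws]]; first exact: ltW.
  suff -> : w = t by rewrite subrr normr0.
  apply/eqP; rewrite eq_le tw andbT leNgt; apply/negP => /(sigma_le Sw).
  by rewrite leNgt ws.
exists F; split=> //; last by move=> t tk; apply: rsF; exact: kappa_sub.
apply: (sub_finite_set _ Sfin) => t [tk nd]; split; first exact: kappa_sub.
move=> Dt; apply: nd; have St := kappa_sub tk.
case: (pselect (right_dense S t)) => [rd|]; last exact: rsF.
(* the finitely many exceptional points stay away from [t] *)
have [q q0 Hq] : exists2 q, 0 < q & forall s, S s -> t - q < s < t + q -> D s.
  have : nbhs t (~` (S `\` D)).
    apply: open_nbhs_nbhs; split; last by case.
    apply: closed_openC; move: Sfin.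
    by apply: accessible_finite_set_closed.1; apply: hausdorff_accessible.
  move=> /nbhs_ballP[q /= q0 Bq]; exists q => // s Ss sq.
  apply: contrapT => nDs; apply: (Bq s); last by split.
  by rewrite /ball /= distrC ltr_distl.
move=> e e0; have [d d0 Hd] := cvg_within_near (cf t Dt rd) e0.
exists (Num.min q d) => [|s Ss]; first by rewrite lt_min q0.
have mq : Num.min q d <= q by rewrite ge_min lexx.
have md : Num.min q d <= d by rewrite ge_min lexx orbT.
rewrite rd => /andP[s1 s2].
have near w : S w -> (t <= w < s) \/ (s <= w < t) -> `|f w - f t| <= e.
  by move=> Sw wst; apply: Hd; [apply: Hq => //|]; case: wst => /andP[]; lra.
case: (leP t s) => [ts|/ltW st].
  rewrite (distrC t) (ger0_norm (_ : 0 <= s - t)) ?subr_ge0//.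
  have -> : F t - F s - f t * (t - s) = - (F s - F t - f t * (s - t)) by lra.
  by rewrite normrN; apply: est => // w Sw wts; apply: near => //; left.
rewrite (ger0_norm (_ : 0 <= t - s)) ?subr_ge0//.
by apply: est => // w Sw wts; apply: near => //; right.
Qed.

(** An antiderivative [F] of [f] yields the antiderivative [F - g] of [ft], so
    integrability is passed from one integrand to the other. *)
Lemma delta_intB D f ft g : piecewise_rd S D f ->
  delta_antideriv S (fun t => f t - ft t) g ->
  delta_int S f a b - delta_int S ft a b = g b - g a.
Proof.
move=> /piecewise_rd_antideriv[F FA] gA; have [cF finF rsF] := FA.
have [cg fing rsg] := gA.
suff FgA : delta_antideriv S ft (fun t => F t - g t).
  by rewrite (delta_int_antideriv FA) (delta_int_antideriv FgA); lra.
have step t : is_delta_deriv S F t (f t) -> is_delta_deriv S g t (f t - ft t) ->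
    is_delta_deriv S (fun t => F t - g t) t (ft t).
  by move=> dF dg; rewrite -(subKr (f t) (ft t)); exact: is_delta_derivB.
split; first exact: continuous_tsB.
- pose E1 := [set t | kappa S t /\ ~ is_delta_deriv S F t (f t)].
  pose E2 := [set t | kappa S t /\ ~ is_delta_deriv S g t (f t - ft t)].
  apply: (@sub_finite_set _ _ (E1 `|` E2)); last by rewrite finite_setU.
  move=> t [tk nd]; case: (pselect (is_delta_deriv S F t (f t))) => dF; last by left.
  by right; split=> // dg; apply: nd; exact: step.
- by move=> t tk nrd; apply: step; [exact: rsF | exact: rsg].
Qed.

(** * Functions of class C1prd *)

Lemma C1prd_scattered_dom f t : C1prd S f -> kappa S t -> ~ right_dense S t ->
  delta_dom S f t.
Proof.
move=> [cf _ _] tk nrd; split=> //.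
exists ((f (sigma S t) - f t) / (sigma S t - t)).
apply: right_scattered_is_delta_deriv => //; first exact: kappa_sub.
by rewrite divfK// subr_eq0 gt_eqF// right_scattered_lt.
Qed.

Lemma is_delta_deriv_dom f t : delta_dom S f t ->
  is_delta_deriv S f t (delta_deriv S f t).
Proof. by case=> _ ex; apply: (xgetPex 0 ex). Qed.

Lemma eq_piecewise_rd D f g : {in D, f =1 g} -> piecewise_rd S D f ->
  piecewise_rd S D g.
Proof.
move=> fg [DS cf lf rf].
have fgF (F : set_system R) l : Filter F -> f s @[s --> within D F] --> l ->
    g s @[s --> within D F] --> l.
  move=> FF; apply: cvg_trans; apply: near_eq_cvg.
  by rewrite near_withinE; apply: filterE => s Ds; apply: fg; rewrite inE.
split=> //.
- by move=> t Dt rd; rewrite -fg ?inE//; apply: fgF; exact: cf.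
- by move=> t St /(lf t St)[l fl]; exists l; exact: fgF.
- by move=> t St /(rf t St)[l fl]; exists l; exact: fgF.
Qed.

Lemma eq_C1prd f g : {in S, f =1 g} -> C1prd S f -> C1prd S g.
Proof.
move=> fg [cf finf prdf].
have derE t : S t -> is_delta_deriv S f t = is_delta_deriv S g t.
  move=> St; apply/funext => d; apply/propext.
  by split; apply: eq_is_delta_deriv => // s Ss; rewrite fg.
have domE : delta_dom S g = delta_dom S f.
  by apply/seteqP; split=> t [tk [d dd]]; split=> //; exists d;
    move: dd; rewrite derE//; exact: kappa_sub.
split; first exact: subspace_eq_continuous cf.
  by rewrite domE.
rewrite domE; apply: eq_piecewise_rd prdf => t; rewrite inE => -[tk _].
by rewrite /delta_deriv derE//; exact: kappa_sub.
Qed.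

End CompactTimeScale.

(** * Invariance of extrema *)

Lemma tsitv_closed (R : realType) (T : set R) (a b : R) :
  closed T -> closed (tsitv T a b).
Proof. by move=> Tcl; apply: closedI => //; exact: itv_closed. Qed.

Theorem lemma3p1 (R : realType) (T : set R) (hT : time_scale T)
  (hT2 : exists s t : R, [/\ T s, T t & s != t])
  (a b : R) (ha : T a) (hb : T b) (hab : a < b) (alpha beta : R)
  (L Lt : R -> R -> R -> R)
  (hL : regular_lagrangian (tsitv T a b) L)
  (hLt : regular_lagrangian (tsitv T a b) Lt)
  (z zt : R -> R -> R)
  (hz : forall t, tsitv T a b t -> cancel (z t) (zt t) /\ cancel (zt t) (z t))
  (hcorr : one_to_one (tsitv T a b)
     (admissible (tsitv T a b) a b alpha beta)
     (admissible (tsitv T a b) a b (zt a alpha) (zt b beta))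
     (corresponding (tsitv T a b) z zt))
  (hG : exists G : R -> R -> R, forall x xt : R -> R,
     admissible (tsitv T a b) a b alpha beta x ->
     admissible (tsitv T a b) a b (zt a alpha) (zt b beta) xt ->
     corresponding (tsitv T a b) z zt x xt ->
     C1prd (tsitv T a b) (fun t => G t (xt t)) /\
     forall t, delta_dom (tsitv T a b) x t -> delta_dom (tsitv T a b) xt t ->
       delta_dom (tsitv T a b) (fun s => G s (xt s)) t ->
       along (tsitv T a b) L x t - along (tsitv T a b) Lt xt t =
       delta_deriv (tsitv T a b) (fun s => G s (xt s)) t)
  (xs : R -> R) :
  (minimizer (admissible (tsitv T a b) a b (zt a alpha) (zt b beta))
     (fun xt => delta_int (tsitv T a b) (along (tsitv T a b) Lt xt) a b) xs ->
   minimizer (admissible (tsitv T a b) a b alpha beta)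
     (fun x => delta_int (tsitv T a b) (along (tsitv T a b) L x) a b)
     (fun t => z t (xs t))) /\
  (maximizer (admissible (tsitv T a b) a b (zt a alpha) (zt b beta))
     (fun xt => delta_int (tsitv T a b) (along (tsitv T a b) Lt xt) a b) xs ->
   maximizer (admissible (tsitv T a b) a b alpha beta)
     (fun x => delta_int (tsitv T a b) (along (tsitv T a b) L x) a b)
     (fun t => z t (xs t))).
Proof.
set S := tsitv T a b in hL hLt hz hcorr hG *.
set P := admissible S a b alpha beta in hcorr hG *.
set Q := admissible S a b (zt a alpha) (zt b beta) in hcorr hG *.
have Scl : closed S by apply: tsitv_closed; case: hT.
have Sa : S a by split=> //=; rewrite in_itv /= lexx ltW.
have Sb : S b by split=> //=; rewrite in_itv /= lexx ltW.
have Sab t : S t -> a <= t <= b by case=> _; rewrite /= in_itv.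
case: hG => G HG.
have JE x xt : P x -> Q xt -> corresponding S z zt x xt ->
    delta_int S (along S L x) a b =
    delta_int S (along S Lt xt) a b + (G b (zt b beta) - G a (zt a alpha)).
  move=> Px Qxt rel; have [Cg dG] := HG x xt Px Qxt rel.
  have [Cx _ _] := Px; have [Cxt xta xtb] := Qxt.
  have [prdL _ _] := hL.2 x Cx.
  pose g s := G s (xt s).
  have gA : delta_antideriv S (fun t => along S L x t - along S Lt xt t) g.
    have dg t : delta_dom S x t -> delta_dom S xt t -> delta_dom S g t ->
        is_delta_deriv S g t (along S L x t - along S Lt xt t).
      by move=> dx dxt dgt; rewrite dG//; exact: is_delta_deriv_dom.
    split; first by case: Cg.
    - pose E h := kappa S `\` delta_dom S h.
      apply: (@sub_finite_set _ _ (E x `|` E xt `|` E g)); last first.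
        by rewrite !finite_setU; case: Cx Cxt Cg => [_ ? _] [_ ? _] [_ ? _].
      move=> t [tk nd]; apply: contrapT => nE; apply: nd.
      by apply: dg; apply: contrapT => nd; apply: nE;
        [left; left | left; right | right].
    - by move=> t tk nrd; apply: dg; apply: (C1prd_scattered_dom Sb Sab).
  have := delta_intB Scl Sa Sb Sab prdL gA.
  by rewrite /g xta xtb; lra.
(* [z t (xs t)] is, on [S], the function that corresponds to [xs] *)
have xsP : Q xs -> P (fun t => z t (xs t)) /\
    corresponding S z zt (fun t => z t (xs t)) xs.
  move=> Qxs; have [x [[Cx xa xb] rel] _] := hcorr.2 xs Qxs.
  split; last by move=> t St; split=> //; rewrite (hz t St).1.
  split; last 2 first.
  - by rewrite -(rel a Sa).1.
  - by rewrite -(rel b Sb).1.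
  by apply: (eq_C1prd Scl Sb Sab) Cx => t; rewrite inE => /rel[].
split=> -[Qxs opt]; have [Pz relz] := xsP Qxs; split=> // x Px;
  have [xt [Qxt rel] _] := hcorr.1 x Px;
  by rewrite (JE _ _ Pz Qxs relz) (JE _ _ Px Qxt rel) lerD2r; exact: opt.
Qed.
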